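(* Let $n=2m$ with $m\geq2$ an integer. The solutions $(\Delta,\rho)$ of the system $X=0$, $T=0$ under the restriction $1+2b^2\rho'\neq0$ are determined by $$\Delta(b^2)=\frac{(a^2-\mu b^2)(1+2b^2\rho')^2}{a^2(1+Eb^2e^{2\rho})}$$ together with $$\ln(b^2)=\int f(\varrho)\,\mathrm{d}\varrho\quad(\mu=0),\qquad\text{or}\qquad\ln\left|\frac{a-\sqrt{a^2-\mu b^2}}{a+\sqrt{a^2-\mu b^2}}\right|=\int f(\varrho)\,\mathrm{d}\varrho\quad(\mu\neq0),$$ where $E$ is a constant, $\varrho:=b^2e^{2\rho}$, and the function $f$ is defined by $$f(\varrho)=\pm\frac{1}{\sqrt{F\varrho^{2-m}+\varrho^2-\frac{2m-1}{2m+2}\cdot\frac{\bar\mu}{a^2}\varrho^3}}$$ when $E=0$, and by $$f(\varrho)=\pm\frac{\varrho^{\frac{m-2}{2}}}{\sqrt{F\iota^3-E^{-m-1}\iota^2\left\{\frac{\bar\mu}{a^2}\iota^{2m}+\sum\limits_{k=0}^{m-1}\frac{(-1)^{m-k}}{2k-1}\binom{m}{k}\left[2(m-k)E+(2m-1)\frac{\bar\mu}{a^2}\right]\iota^{2k}\right\}}}$$ when $E\neq0$, in which $F$ is a constant and $\iota:=\sqrt{1+E\varrho}$. Here $$\begin{aligned}X=\frac{1}{b^2\Delta}\Big\{&a^2\Delta(n-2\Delta)+b^2[\mu\Delta-(a^2-\mu b^2)\Delta'](1+2b^2\rho')-(n-2)(a^2-\mu b^2)\Delta(1+2b^2\rho')^2\\&-2(a^2-\mu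 b^2)b^2\Delta(1+2b^2\rho')'-(n-1)\bar\mu b^2\Delta e^{2\rho}\Big\},\end{aligned}$$ $$\begin{aligned}T=\ &(a^2-\mu b^2)\big\{\Delta^2-b^2\Delta'(1+2b^2\rho')-\Delta(1+2b^2\rho')^2+2b^2\Delta(1+2b^2\rho')'\big\}\\&+\mu b^2\big\{\Delta^2-\Delta(1+2b^2\rho')\big\}.\end{aligned}$$
   Context: Here $a\neq0$, $\mu$, $\bar\mu$ are real constants, and $b^2$ is treated as an independent real variable ranging over an open interval in $(0,\infty)$ on which $a^2-\mu b^2>0$; $\Delta=\Delta(b^2)>0$ and $\rho=\rho(b^2)$ are smooth real functions on this interval, and a prime denotes $d/d(b^2)$ (so $(1+2b^2\rho')'=2\rho'+2b^2\rho''$). Equations are required to hold identically on the interval. The symbol $\int f(\varrho)\,\mathrm{d}\varrho$ denotes an antiderivative of $f$ (with arbitrary constant of integration) evaluated at $\varrho=\varrho(b^2)=b^2e^{2\rho(b^2)}$; thus the relation determines $\varrho$, and hence $\rho$, implicitly as a function of $b^2$. *)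

(* Defs.v *)
From Stdlib Require Import Reals.
From Coquelicot Require Import Coquelicot.
Open Scope R_scope.

(* Throughout, the real variable [t] stands for b^2, taken as an independent
   variable; a prime in the formulas is [Derive], the derivative in [t]. *)

(* The open interval (lo, hi); the endpoints may be infinite. *)
Definition in_itv (lo hi : Rbar) (t : R) : Prop :=
  Rbar_lt lo t /\ Rbar_lt t hi.

Definition smooth_on (I : R -> Prop) (g : R -> R) : Prop :=
  forall (k : nat) (t : R), I t -> ex_derive_n g k t.

(* 1 + 2 b^2 rho' *)
Definition pfun (rho : R -> R) (t : R) : R := 1 + 2 * t * Derive rho t.

(* varrho = b^2 e^(2 rho) *)
Definition varrho (rho : R -> R) (t : R) : R := t * exp (2 * rho t).

Definition Xfun (n : nat) (a mu mubar : R) (Delta rho : R -> R) (t : R) : R :=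
  / (t * Delta t) *
  ( a ^ 2 * Delta t * (INR n - 2 * Delta t)
    + t * (mu * Delta t - (a ^ 2 - mu * t) * Derive Delta t) * pfun rho t
    - (INR n - 2) * (a ^ 2 - mu * t) * Delta t * pfun rho t ^ 2
    - 2 * (a ^ 2 - mu * t) * t * Delta t * Derive (pfun rho) t
    - (INR n - 1) * mubar * t * Delta t * exp (2 * rho t) ).

Definition Tfun (a mu : R) (Delta rho : R -> R) (t : R) : R :=
  (a ^ 2 - mu * t) *
    ( Delta t ^ 2 - t * Derive Delta t * pfun rho t
      - Delta t * pfun rho t ^ 2 + 2 * t * Delta t * Derive (pfun rho) t )
  + mu * t * (Delta t ^ 2 - Delta t * pfun rho t).

Definition iota (E r : R) : R := sqrt (1 + E * r).

(* The expression under the square root in f, at varrho = r. *)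
Definition radicand (m : nat) (a mubar E F r : R) : R :=
  if Req_EM_T E 0 then
    F * Rpower r (2 - INR m) + r ^ 2
    - (2 * INR m - 1) / (2 * INR m + 2) * (mubar / a ^ 2) * r ^ 3
  else
    F * iota E r ^ 3
    - powerRZ E (- Z.of_nat m - 1) * iota E r ^ 2 *
      ( mubar / a ^ 2 * iota E r ^ (2 * m)
        + sum_f_R0
            (fun k : nat =>
               (-1) ^ (m - k) / (2 * INR k - 1) * Binomial.C m k
               * (2 * (INR m - INR k) * E + (2 * INR m - 1) * (mubar / a ^ 2))
               * iota E r ^ (2 * k))
            (m - 1) ).

(* [s] is the sign, 1 or -1. *)
Definition f (m : nat) (a mubar E F s r : R) : R :=
  if Req_EM_T E 0 then
    s * (1 / sqrt (radicand m a mubar E F r))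
  else
    s * (Rpower r ((INR m - 2) / 2) / sqrt (radicand m a mubar E F r)).

Definition log_side (a mu t : R) : R :=
  if Req_EM_T mu 0 then ln t
  else ln (Rabs ((a - sqrt (a ^ 2 - mu * t)) / (a + sqrt (a ^ 2 - mu * t)))).

(* [G] is an antiderivative of f on the values taken by varrho on [I], all of
   them in the domain of definition of the real formula for f.  When [I] is an
   open interval in (0, +oo) and 1 + 2 b^2 rho' has no zero on it, these values
   form an open interval, so [G] is unique there up to an additive constant. *)
Definition antiderivative_f (m : nat) (a mubar E F s : R)
    (I : R -> Prop) (rho G : R -> R) : Prop :=
  forall t : R, I t ->
    0 < 1 + E * varrho rho t /\
    0 < radicand m a mubar E F (varrho rho t) /\
    is_derive G (varrho rho t) (f m a mubar E F s (varrho rho t)).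

(* Main.v *)
(** Write [t = b^2], [A = a^2 - mu t], [p = 1 + 2 t rho'], [r = varrho], so that
    [t r' = p r].  Put [w = A p^2 / (a^2 Delta)] and [q = A p^2 / a^2].  Then [T = 0]
    says [t w' = p (w - 1)], i.e. [w = 1 + E r], which is the formula for [Delta]; and
    the combination [t X - T / Delta] eliminates [Delta'] and says that
    [2 t q' = p (2 m - (3 / w + 2 m - 3) q - (2 m - 1) (mubar / a^2) r)], a first-order
    linear equation for [q] as a function of [r].  Its general solution is the radicand
    divided by [r^2] (if [E = 0]) or by [r^m] (if [E <> 0]), so that [f r = +-1/(r sqrt q)].
    Since [log_side] has derivative [+-a / (t sqrt A)], differentiating the implicit
    relation gives [q = A p^2 / a^2] for this solution, and conversely. *)

Require Import Defs.
From Stdlib Require Import Factorial Reals Lra Lia.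
From Coquelicot Require Import Coquelicot.
Open Scope R_scope.

(** * The finite sum in the radicand and its derivative *)

Lemma is_derive_sum_f_R0 (u du : nat -> R -> R) (N : nat) (x : R) :
  (forall k, is_derive (u k) x (du k x)) ->
  is_derive (fun y => sum_f_R0 (fun k => u k y) N) x
    (sum_f_R0 (fun k => du k x) N).
Proof.
  intros H. induction N as [|N IH]; simpl.
  - apply H.
  - apply (is_derive_plus (fun y => sum_f_R0 (fun k => u k y) N) (u (S N))); auto.
Qed.

Lemma C_absorption (m k : nat) :
  (k <= m)%nat ->
  (INR (S m) - INR k) * Binomial.C (S m) k = INR (S m) * Binomial.C m k.
Proof.
  intros Hk. unfold Binomial.C.
  replace (S m - k)%nat with (S (m - k)) by lia.
  rewrite 2!fact_simpl, 2!mult_INR, (S_INR (m - k)), minus_INR, S_INR by lia.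
  apply le_INR in Hk.
  assert (INR (fact k) <> 0) by apply INR_fact_neq_0.
  assert (INR (fact (m - k)) <> 0) by apply INR_fact_neq_0.
  field. repeat split; try lra.
Qed.

(* The braces of [radicand] for [E <> 0], at [iota = x]. *)
Definition brace (m : nat) (c E x : R) : R :=
  c * x ^ (2 * m)
  + sum_f_R0
      (fun k : nat =>
         (-1) ^ (m - k) / (2 * INR k - 1) * Binomial.C m k
         * (2 * (INR m - INR k) * E + (2 * INR m - 1) * c) * x ^ (2 * k))
      (m - 1).

Lemma two_INR_minus_1_neq_0 (k : nat) : 2 * INR k - 1 <> 0.
Proof.
  destruct k as [|k]; [simpl; lra|].
  rewrite S_INR. pose proof (pos_INR k). lra.
Qed.

(** Here [z] stands for [iota ^ 2]. The terms in [c] are the binomial expansion of [(z - 1) ^ S m],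
    whose top term is the one standing outside the sum. In the terms in [E], absorption turns
    [(S m - k) C (S m) k] into [S m * C m k], so they add up to a multiple of [(z - 1) ^ m], with a
    minus sign because [S m - k] and [m - k] differ in parity. *)
Lemma brace_alternating_sum (m : nat) (c E z : R) :
  (2 * INR (S m) - 1) * c * z ^ S m
  + sum_f_R0
      (fun k => (-1) ^ (S m - k) * Binomial.C (S m) k
         * (2 * (INR (S m) - INR k) * E + (2 * INR (S m) - 1) * c) * z ^ k) m
  = (z - 1) ^ m * ((2 * INR (S m) - 1) * c * (z - 1) - 2 * INR (S m) * E).
Proof.
  pose proof (binomial z (-1) m) as B0.
  pose proof (binomial z (-1) (S m)) as B1.
  rewrite tech5 in B1.
  replace (S m - S m)%nat with 0%nat in B1 by lia.
  replace (Binomial.C (S m) (S m)) with 1 in B1.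
  2:{ unfold Binomial.C. rewrite Nat.sub_diag. simpl (fact 0).
      pose proof (INR_fact_neq_0 (S m)). simpl (INR 1). field; auto. }
  rewrite (sum_eq _
    (fun k => (Binomial.C (S m) k * z ^ k * (-1) ^ (S m - k))
                * ((2 * INR (S m) - 1) * c)
              + (Binomial.C m k * z ^ k * (-1) ^ (m - k))
                * (- (2 * INR (S m) * E)))).
  - rewrite plus_sum, <- 2!scal_sum, <- B0.
    replace (sum_f_R0 (fun k => Binomial.C (S m) k * z ^ k * (-1) ^ (S m - k)) m)
      with ((z + -1) ^ S m - z ^ S m) by (rewrite B1; simpl; ring).
    replace (z + -1) with (z - 1) by ring.
    simpl (_ ^ S m). ring.
  - intros k Hk.
    replace ((-1) ^ (m - k)) with (- (-1) ^ (S m - k)).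
    2:{ replace (S m - k)%nat with (S (m - k)) by lia. simpl. ring. }
    replace (Binomial.C m k * z ^ k * - (-1) ^ (S m - k) * - (2 * INR (S m) * E))
      with ((INR (S m) * Binomial.C m k) * (z ^ k * (-1) ^ (S m - k) * (2 * E)))
      by ring.
    rewrite <- C_absorption by assumption. ring.
Qed.

(** The operator [x d/dx - 1] multiplies [x ^ (2 * k)] by [2 k - 1], which cancels the denominators
    of the coefficients. What remains is the alternating sum just evaluated, so the braces satisfy a
    first-order linear equation. *)
Lemma is_derive_brace (m : nat) (c E x : R) : x <> 0 ->
  is_derive (brace (S m) c E) x
    ((brace (S m) c E x
      + (x ^ 2 - 1) ^ m * ((2 * INR (S m) - 1) * c * (x ^ 2 - 1) - 2 * INR (S m) * E))
     / x).
Proof.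
  intros Hx.
  rewrite <- brace_alternating_sum.
  unfold brace. replace (S m - 1)%nat with m by lia.
  (* Dividing by [x] keeps the exponent [2 * k] and avoids a truncated predecessor at [k = 0]. *)
  assert (Hpow : forall k, is_derive (fun y => y ^ (2 * k)) x
                   (2 * INR k * x ^ (2 * k) / x)).
  { intros k. evar_last.
    - apply (is_derive_pow (fun y => y) (2 * k) x 1 (is_derive_id x)).
    - destruct k as [|k]; [simpl; unfold Rdiv; ring|].
      replace (x ^ (2 * S k)) with (x * x ^ pred (2 * S k)).
      + rewrite mult_INR. simpl (INR 2). field; auto.
      + rewrite tech_pow_Rmult. f_equal; lia. }
  set (w := fun k : nat => (-1) ^ (S m - k) / (2 * INR k - 1) * Binomial.C (S m) k
         * (2 * (INR (S m) - INR k) * E + (2 * INR (S m) - 1) * c)).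
  evar_last.
  - apply (is_derive_plus (fun x => c * x ^ (2 * S m))
             (fun x => sum_f_R0 (fun k => w k * x ^ (2 * k)) m)).
    + apply is_derive_scal, Hpow.
    + apply (is_derive_sum_f_R0 (fun k y => w k * y ^ (2 * k))
               (fun k y => w k * (2 * INR k * y ^ (2 * k) / y))).
      intros k. apply is_derive_scal, Hpow.
  - rewrite (sum_eq (fun k => w k * (2 * INR k * x ^ (2 * k) / x))
      (fun k => (w k * x ^ (2 * k)) * / x
         + ((-1) ^ (S m - k) * Binomial.C (S m) k
         * (2 * (INR (S m) - INR k) * E + (2 * INR (S m) - 1) * c) * (x ^ 2) ^ k) * / x)).
    + rewrite plus_sum, <- 2!scal_sum, <- pow_mult.
      change (@plus _) with Rplus; unfold w; field; auto.
    + intros k _. unfold w. rewrite pow_mult.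
      pose proof (two_INR_minus_1_neq_0 k). field; auto.
Qed.

(** * The linear equation in [varrho], its general solution, and [f] in terms of it *)

Definition weight (m : nat) (E r : R) : R :=
  if Req_EM_T E 0 then r ^ 2 else r ^ m.

(** The candidate for [q] as a function of [varrho], with [F] as the constant of integration. *)
Definition profile (m : nat) (a mubar E F r : R) : R :=
  radicand m a mubar E F r / weight m E r.

(* The right-hand side of the linear equation [dq/dr = slope m c E r q],
   with [c = mubar / a^2]. *)
Definition slope (m : nat) (c E r y : R) : R :=
  (2 * INR m - (3 / (1 + E * r) + 2 * INR m - 3) * y - (2 * INR m - 1) * c * r)
  / (2 * r).

Lemma weight_pos (m : nat) (E r : R) : 0 < r -> 0 < weight m E r.
Proof. intros Hr. unfold weight. destruct Req_EM_T; apply pow_lt, Hr. Qed.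

Lemma iota_pos (E r : R) : 0 < 1 + E * r -> 0 < Defs.iota E r.
Proof. apply sqrt_lt_R0. Qed.

(** For [E <> 0], the remainder left by [is_derive_brace] contains [(iota ^ 2 - 1) ^ (m - 1) = (E r)
    ^ (m - 1)]. This cancels against the factor [E ^ (- m - 1)] and the weight [r ^ m], leaving the
    inhomogeneous terms of [slope]. *)
Lemma is_derive_profile (m : nat) (a mubar E F r : R) :
  (2 <= m)%nat -> 0 < r -> 0 < 1 + E * r ->
  is_derive (profile m a mubar E F) r
    (slope m (mubar / a ^ 2) E r (profile m a mubar E F r)).
Proof.
  intros Hm Hr HEr. unfold profile, weight, radicand, slope.
  destruct (Req_EM_T E 0) as [->|HE].
  - unfold Rpower. pose proof (pos_INR m).
    set (c := mubar / a ^ 2). auto_derive.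
    + repeat split; auto; nra.
    + unfold Rdiv. field. lra.
  - fold (brace m (mubar / a ^ 2) E (Defs.iota E r)).
    pose proof (iota_pos E r HEr) as Hi.
    assert (Hi2 : Defs.iota E r ^ 2 = 1 + E * r) by (apply pow2_sqrt; lra).
    destruct m as [|k]; [lia|].
    set (c := mubar / a ^ 2).
    set (K := powerRZ E (- Z.of_nat (S k) - 1)).
    assert (HK : K = / (E ^ 2 * E ^ k)).
    { unfold K. replace (- Z.of_nat (S k) - 1)%Z with (- Z.of_nat (2 + k))%Z by lia.
      rewrite powerRZ_neg', <- pow_powerRZ, pow_add. reflexivity. }
    apply is_derive_ext with
      (fun y => (fun x => F * x ^ 3 - K * x ^ 2 * brace (S k) c E x) (Defs.iota E y)
                / y ^ S k); [reflexivity|].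
    evar_last.
    + apply is_derive_div.
      * apply (is_derive_comp (fun x => F * x ^ 3 - K * x ^ 2 * brace (S k) c E x)).
        -- apply (is_derive_minus (fun x => F * x ^ 3)).
           ++ apply is_derive_scal, (is_derive_pow (fun y => y) 3 _ 1 (is_derive_id _)).
           ++ apply (is_derive_mult (fun x => K * x ^ 2)).
              ** apply is_derive_scal, (is_derive_pow (fun y => y) 2 _ 1 (is_derive_id _)).
              ** apply is_derive_brace. lra.
              ** exact Rmult_comm.
        -- instantiate (1 := E / (2 * Defs.iota E r)). unfold Defs.iota. auto_derive; auto.
           field. apply Rgt_not_eq, Hi.
      * apply (is_derive_pow (fun y => y) (S k) _ 1 (is_derive_id _)).
      * apply pow_nonzero. lra.
    + change (@plus _) with Rplus. change (@mult _) with Rmult.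
      change (@scal _ _) with Rmult.
      match goal with |- context [minus ?x ?y] => change (minus x y) with (x - y) end.
      rewrite <- Hi2.
      replace (Defs.iota E r ^ 2 - 1) with (E * r) by lra.
      rewrite Rpow_mult_distr, HK. simpl (_ ^ S k). simpl (pred _).
      assert (HEk : E ^ k <> 0) by (apply pow_nonzero; auto).
      assert (Hrk : r ^ k <> 0) by (apply pow_nonzero; lra).
      (* With the powers and the braces made opaque, substituting [r = (x ^ 2 - 1) / E] for
         [x = iota] leaves an identity of rational functions. *)
      generalize dependent (r ^ k). generalize dependent (E ^ k).
      generalize (brace (S k) c E (Defs.iota E r)). intros B q _ Hq u Hu.
      generalize dependent (Defs.iota E r). intros x Hx Hx2.
      assert (Hr' : r = (x ^ 2 - 1) / E) by (rewrite Hx2; field; auto).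
      clearbody c. set (N := INR (S k)).
      replace (INR 3) with 3 by (simpl; ring). replace (INR 2) with 2 by (simpl; ring).
      assert (x * x - 1 <> 0) by nra.
      subst r. field. repeat split; auto; nra.
Qed.

Lemma profile_pos_iff (m : nat) (a mubar E F r : R) : 0 < r ->
  0 < profile m a mubar E F r <-> 0 < radicand m a mubar E F r.
Proof.
  intros Hr. unfold profile. pose proof (weight_pos m E r Hr) as Hw. split; intros H.
  - replace (radicand m a mubar E F r)
      with (radicand m a mubar E F r / weight m E r * weight m E r) by (field; lra).
    now apply Rmult_lt_0_compat.
  - now apply Rdiv_lt_0_compat.
Qed.

(** The square root of the weight is [r] if [E = 0] and [r ^ (m / 2)] otherwise. Pulling it out of
    the radicand gives both cases of [f] the same form. *)
Lemma f_profile (m : nat) (a mubar E F s r : R) : 0 < r ->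
  Defs.f m a mubar E F s r = s / (r * sqrt (profile m a mubar E F r)).
Proof.
  intros Hr. pose proof (weight_pos m E r Hr) as Hw.
  assert (Hsqrt : sqrt (radicand m a mubar E F r)
                  = sqrt (weight m E r) * sqrt (profile m a mubar E F r)).
  { rewrite <- sqrt_mult_alt by lra. f_equal. unfold profile. field. lra. }
  unfold Defs.f. rewrite Hsqrt. unfold weight.
  destruct (Req_EM_T E 0).
  - rewrite sqrt_pow2 by lra. unfold Rdiv. ring.
  - rewrite <- (Rpower_pow m r Hr), <- Rpower_sqrt, Rpower_mult by apply exp_pos.
    replace ((INR m - 2) / 2) with (INR m * / 2 + Ropp 1) by field.
    rewrite Rpower_plus, (Rpower_Ropp r 1), Rpower_1 by assumption.
    assert (Rpower r (INR m * / 2) <> 0) by apply Rgt_not_eq, exp_pos.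
    unfold Rdiv. rewrite 2!Rinv_mult. generalize (/ sqrt (profile m a mubar E F r)). intros q. field. split; auto; lra.
Qed.

(* The coefficient of [F] in [profile]: a solution of the homogeneous equation. *)
Definition profile_hom (m : nat) (E r : R) : R :=
  (if Req_EM_T E 0 then Rpower r (2 - INR m) else Defs.iota E r ^ 3) / weight m E r.

Lemma profile_affine (m : nat) (a mubar E F r : R) :
  profile m a mubar E F r = profile m a mubar E 0 r + F * profile_hom m E r.
Proof.
  unfold profile, profile_hom, radicand, Rdiv. destruct Req_EM_T; ring.
Qed.

Lemma profile_hom_pos (m : nat) (E r : R) :
  0 < r -> 0 < 1 + E * r -> 0 < profile_hom m E r.
Proof.
  intros Hr HEr. apply Rdiv_lt_0_compat; [|now apply weight_pos].
  destruct Req_EM_T; [apply exp_pos | now apply pow_lt, iota_pos].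
Qed.

(** * The domain of [f], its continuity there, and its antiderivative *)

Lemma locally_gt_0 (g : R -> R) (x : R) :
  continuous g x -> 0 < g x -> locally x (fun y => 0 < g y).
Proof. intros Hg Hx. exact (Hg _ (open_gt 0 (g x) Hx)). Qed.

Lemma is_derive_continuous (g : R -> R) (x l : R) :
  is_derive g x l -> continuous g x.
Proof. intros H. apply (ex_derive_continuous g). now exists l. Qed.

Definition regular (m : nat) (a mubar E F r : R) : Prop :=
  0 < r /\ 0 < 1 + E * r /\ 0 < radicand m a mubar E F r.

(** Positivity of the radicand is traded for that of [profile], whose continuity follows from
    [is_derive_profile]. *)
Lemma locally_regular (m : nat) (a mubar E F r : R) : (2 <= m)%nat ->
  regular m a mubar E F r -> locally r (regular m a mubar E F).
Proof.
  intros Hm (Hr & HEr & HR).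
  apply (filter_imp (fun y => 0 < y /\ 0 < 1 + E * y /\ 0 < profile m a mubar E F y)).
  - intros y (Hy & HEy & HP). repeat split; auto. now apply profile_pos_iff.
  - repeat apply filter_and.
    + exact (open_gt 0 r Hr).
    + apply (locally_gt_0 (fun y => 1 + E * y)); auto.
      apply (ex_derive_continuous (fun y => 1 + E * y)). auto_derive; auto.
    + apply locally_gt_0; [|now apply profile_pos_iff].
      now eapply is_derive_continuous, is_derive_profile.
Qed.

Lemma continuous_f (m : nat) (a mubar E F s r : R) : (2 <= m)%nat ->
  regular m a mubar E F r -> continuous (Defs.f m a mubar E F s) r.
Proof.
  intros Hm (Hr & HEr & HR).
  apply continuous_ext_loc with (fun y => s / (y * sqrt (profile m a mubar E F y))).
  - apply (filter_imp (fun y => 0 < y)); [|exact (open_gt 0 r Hr)].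
    intros y Hy. symmetry. now apply f_profile.
  - apply profile_pos_iff in HR; auto.
    assert (He : ex_derive (profile m a mubar E F) r)
      by (eexists; now apply is_derive_profile).
    apply (ex_derive_continuous (fun y => s / (y * sqrt (profile m a mubar E F y)))).
    auto_derive. repeat split; auto.
    apply Rgt_not_eq, Rmult_lt_0_compat; auto. now apply sqrt_lt_R0.
Qed.

(** A fundamental theorem of calculus for a set [J] that may be disconnected, as the domain of [f]
    may be: it is enough that [J] contains the segment from [x0] to [x] and a neighbourhood of [x].
    For [y] near [x], the integral to [y] is split at [x]. *)
Lemma is_derive_RInt_regular (g : R -> R) (J : R -> Prop) (x0 x : R) :
  (forall y, J y -> continuous g y) ->
  locally x J ->
  (forall y, Rmin x0 x <= y <= Rmax x0 x -> J y) ->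
  is_derive (RInt g x0) x (g x).
Proof.
  intros Hg Hloc Hseg.
  assert (Hx : J x) by (apply Hseg; split; [apply Rmin_r | apply Rmax_r]).
  apply is_derive_RInt with x0; [|now apply Hg].
  destruct Hloc as [eps Heps]. exists eps. intros y Hy.
  apply (RInt_correct g), ex_RInt_Chasles with x.
  - apply (ex_RInt_continuous g). auto.
  - apply (ex_RInt_continuous g). intros z Hz. apply Hg, Heps.
    change (Rabs (z - x) < eps). change (Rabs (y - x) < eps) in Hy.
    revert Hz. unfold Rmin, Rmax. destruct Rle_dec; intros Hz;
      apply Rabs_def2 in Hy; apply Rabs_def1; lra.
Qed.

(** * Calculus on an open interval with possibly infinite endpoints *)

Lemma in_itv_convex (lo hi : Rbar) (x y z : R) :
  in_itv lo hi x -> in_itv lo hi y -> x <= z <= y -> in_itv lo hi z.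
Proof.
  intros [H1 _] [_ H2] [H3 H4]. split.
  - now apply Rbar_lt_le_trans with x.
  - now apply Rbar_le_lt_trans with y.
Qed.

Lemma in_itv_convex_minmax (lo hi : Rbar) (x y z : R) :
  in_itv lo hi x -> in_itv lo hi y -> Rmin x y <= z <= Rmax x y -> in_itv lo hi z.
Proof.
  intros Hx Hy. unfold Rmin, Rmax. destruct Rle_dec; apply in_itv_convex; auto.
Qed.

Lemma locally_in_itv (lo hi : Rbar) (x : R) :
  in_itv lo hi x -> locally x (in_itv lo hi).
Proof.
  intros [H1 H2]. apply filter_and.
  - exact (open_Rbar_gt' (Finite x) lo H1).
  - exact (open_Rbar_lt' (Finite x) hi H2).
Qed.

Lemma in_itv_inhabited (lo hi : Rbar) :
  Rbar_le 0 lo -> Rbar_lt lo hi -> exists t : R, in_itv lo hi t.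
Proof.
  intros H0 H. destruct lo as [lo| |]; [|easy..].
  destruct hi as [hi| |]; [| |easy].
  - exists ((lo + hi) / 2). simpl in H. split; simpl; lra.
  - exists (lo + 1). split; simpl; auto; lra.
Qed.

Lemma constant_on_itv (lo hi : Rbar) (g : R -> R) :
  (forall t, in_itv lo hi t -> is_derive g t 0) ->
  forall x y, in_itv lo hi x -> in_itv lo hi y -> g x = g y.
Proof.
  intros Hg.
  assert (Hlt : forall x y, in_itv lo hi x -> in_itv lo hi y -> x < y -> g x = g y).
  { intros x y Hx Hy Hxy. apply (eq_is_derive g); auto.
    intros t Ht. apply Hg. now apply in_itv_convex with x y. }
  intros x y Hx Hy. destruct (Rtotal_order x y) as [H|[->|H]]; auto.
  symmetry; auto.
Qed.

(** After ordering the two points, one seeks a root of [g - v] or of [v - g], whichever rises from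
    negative to positive. An endpoint where [g] equals [v] is treated apart, because the signs must
    be strict. *)
Lemma IVT_on_itv (lo hi : Rbar) (g : R -> R) (x y v : R) :
  (forall t, in_itv lo hi t -> continuous g t) ->
  in_itv lo hi x -> in_itv lo hi y -> Rmin (g x) (g y) <= v <= Rmax (g x) (g y) ->
  exists z, in_itv lo hi z /\ g z = v.
Proof.
  intros Hg.
  assert (Hlt : forall (h : R -> R) x y, (forall t, in_itv lo hi t -> continuous h t) ->
            in_itv lo hi x -> in_itv lo hi y -> x < y -> h x < 0 -> 0 < h y ->
            exists z, in_itv lo hi z /\ h z = 0).
  { clear. intros h x y Hh Hx Hy Hxy Hx0 Hy0.
    assert (Hc : forall t, x <= t <= y -> continuity_pt h t).
    { intros t Ht. apply continuity_pt_filterlim, Hh. now apply in_itv_convex with x y. }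
    destruct (Ranalysis5.IVT_interv h x y Hc Hxy Hx0 Hy0) as [z [Hz Hz0]].
    exists z. split; auto. now apply in_itv_convex with x y. }
  assert (Hc1 : forall t, in_itv lo hi t -> continuous (fun t => g t - v) t).
  { intros t Ht. apply (continuous_minus g (fun _ => v)); auto. apply continuous_const. }
  assert (Hc2 : forall t, in_itv lo hi t -> continuous (fun t => v - g t) t).
  { intros t Ht. apply (continuous_minus (fun _ => v) g); auto. apply continuous_const. }
  assert (Hwlog : forall x y, in_itv lo hi x -> in_itv lo hi y -> x < y ->
            Rmin (g x) (g y) <= v <= Rmax (g x) (g y) -> exists z, in_itv lo hi z /\ g z = v).
  { clear x y. intros x y Hx Hy Hxy Hv.
    destruct (Req_dec (g x) v) as [|Hxv]; [now exists x|].
    destruct (Req_dec (g y) v) as [|Hyv]; [now exists y|].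
    revert Hv. unfold Rmin, Rmax. destruct Rle_dec; intros Hv.
    - destruct (Hlt (fun t => g t - v) x y) as [z [Hz Hz0]]; auto; try lra.
      exists z. split; auto; lra.
    - destruct (Hlt (fun t => v - g t) x y) as [z [Hz Hz0]]; auto; try lra.
      exists z. split; auto; lra. }
  intros Hx Hy Hv. destruct (Rtotal_order x y) as [H|[->|H]].
  - now apply (Hwlog x y).
  - exists y. split; auto. revert Hv. unfold Rmin, Rmax. destruct Rle_dec; lra.
  - apply (Hwlog y x); auto. now rewrite Rmin_comm, Rmax_comm.
Qed.

Lemma constant_sign_on_itv (lo hi : Rbar) (g : R -> R) (x y : R) :
  (forall t, in_itv lo hi t -> continuous g t) ->
  (forall t, in_itv lo hi t -> g t <> 0) ->
  in_itv lo hi x -> in_itv lo hi y -> 0 < g x -> 0 < g y.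
Proof.
  intros Hc Hn Hx Hy H. destruct (Rlt_le_dec 0 (g y)) as [|Hle]; auto.
  destruct (IVT_on_itv lo hi g x y 0) as [z [Hz Hz0]]; auto.
  - rewrite Rmin_right, Rmax_left; lra.
  - now elim (Hn z).
Qed.

(** * The derivative of the logarithmic side *)

(** If [mu = 0], the derivative [1 / t] equals [Rabs a / (t * sqrt (a ^ 2))]; if [mu <> 0], the
    numerator is [a] with its sign. Only its square, [a ^ 2] in both cases, and its constancy in [t]
    matter later. *)
Definition log_side_num (a mu : R) : R := if Req_EM_T mu 0 then Rabs a else a.

Lemma log_side_num_sqr (a mu : R) : log_side_num a mu ^ 2 = a ^ 2.
Proof. unfold log_side_num. destruct Req_EM_T; auto. apply pow2_abs. Qed.

Lemma is_derive_log_side (a mu t : R) :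
  a <> 0 -> 0 < t -> 0 < a ^ 2 - mu * t ->
  is_derive (log_side a mu) t (log_side_num a mu / (t * sqrt (a ^ 2 - mu * t))).
Proof.
  intros Ha Ht HA. unfold log_side, log_side_num.
  destruct (Req_EM_T mu 0) as [->|Hmu].
  - replace (a ^ 2 - 0 * t) with (Rabs a ^ 2) by (rewrite pow2_abs; ring).
    rewrite sqrt_pow2 by apply Rabs_pos. pose proof (Rabs_no_R0 a Ha).
    auto_derive; auto. field. split; auto; lra.
  (* The two factors have product [mu * y], which is nonzero. *)
  - assert (Hneq : forall y, 0 < y -> 0 < a ^ 2 - mu * y ->
              a - sqrt (a ^ 2 - mu * y) <> 0 /\ a + sqrt (a ^ 2 - mu * y) <> 0).
    { intros y Hy HAy.
      assert (Hs : sqrt (a ^ 2 - mu * y) ^ 2 = a ^ 2 - mu * y) by (apply pow2_sqrt; lra).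
      assert (mu * y <> 0) by (apply Rmult_integral_contrapositive; split; auto; lra).
      assert (Hp : (a - sqrt (a ^ 2 - mu * y)) * (a + sqrt (a ^ 2 - mu * y)) <> 0)
        by (intros H0; lra).
      split; intros H0; rewrite H0 in Hp; lra. }
    (* With [w] the square root, [(a - w) * (a + w) = mu * y] gives [(a - w) / (a + w) = (a - w) ^ 2
       / (mu * y)], so the absolute value only falls on the constant [mu]. *)
    apply is_derive_ext_loc with
      (fun y => ln ((a - sqrt (a ^ 2 - mu * y)) ^ 2 / (Rabs mu * y))).
    + apply (filter_imp (fun y => 0 < y /\ 0 < a ^ 2 - mu * y)).
      * intros y [Hy HAy]. destruct (Hneq y Hy HAy) as [H1 H2]. f_equal.
        set (w := sqrt (a ^ 2 - mu * y)) in *.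
        assert (Hs : w ^ 2 = a ^ 2 - mu * y) by (apply pow2_sqrt; lra).
        replace ((a - w) / (a + w)) with ((a - w) ^ 2 / (mu * y)).
        -- rewrite Rabs_div by (apply Rmult_integral_contrapositive; split; auto; lra).
           rewrite Rabs_mult, (Rabs_pos_eq y) by lra.
           rewrite (Rabs_pos_eq ((a - w) ^ 2)) by apply pow2_ge_0. reflexivity.
        -- replace (mu * y) with ((a - w) * (a + w)) by lra. field; auto.
      * apply filter_and; [exact (open_gt 0 t Ht)|].
        apply (locally_gt_0 (fun y => a ^ 2 - mu * y)); auto.
        apply (ex_derive_continuous (fun y => a ^ 2 - mu * y)). auto_derive; auto.
    + destruct (Hneq t Ht HA) as [H1 H2].
      pose proof (Rabs_no_R0 mu Hmu) as Hamu. pose proof (Rabs_pos_lt mu Hmu).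
      pose proof (sqrt_lt_R0 _ HA) as Hw0.
      assert (Hs : sqrt (a ^ 2 - mu * t) ^ 2 = a ^ 2 - mu * t) by (apply pow2_sqrt; lra).
      auto_derive.
      * replace (a * (a * 1) + - (mu * t)) with (a ^ 2 - mu * t) by ring.
        repeat split; auto.
        -- apply Rmult_integral_contrapositive; split; lra.
        -- apply Rdiv_lt_0_compat.
           ++ apply (pow2_gt_0 _ H1).
           ++ apply Rmult_lt_0_compat; lra.
      * replace (a * (a * 1) + - (mu * t)) with (a ^ 2 - mu * t) by ring.
        set (w := sqrt (a ^ 2 - mu * t)) in *.
        assert (Hmu' : mu = (a - w) * (a + w) / t) by (field_simplify_eq; lra).
        (* The constant [Rabs mu] cancels in the logarithmic derivative; the other occurrences of
           [mu] are eliminated in favour of [w]. *)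
        generalize dependent (Rabs mu). intros z Hz _.
        rewrite Hmu'. field. repeat split; auto; lra.
Qed.

(** * The system rewritten as two differential equations for [w] and [q] *)

Definition wfun (a mu : R) (Delta rho : R -> R) (t : R) : R :=
  (a ^ 2 - mu * t) * pfun rho t ^ 2 / (a ^ 2 * Delta t).

Definition qfun (a mu : R) (rho : R -> R) (t : R) : R :=
  (a ^ 2 - mu * t) * pfun rho t ^ 2 / a ^ 2.

Lemma is_derive_varrho (rho : R -> R) (t : R) :
  t <> 0 -> ex_derive rho t ->
  is_derive (varrho rho) t (pfun rho t * varrho rho t / t).
Proof.
  intros Ht Hrho. unfold varrho, pfun. auto_derive; auto.
  change (Derive (fun x => rho x)) with (Derive rho). field; auto.
Qed.

(** An exact identity in which [Tfun] is the defect of the equation [t w' = p (w - 1)], so that both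
    directions of the equivalence can be read from it. *)
Lemma is_derive_wfun (a mu : R) (Delta rho : R -> R) (t : R) :
  a <> 0 -> t <> 0 -> Delta t <> 0 -> ex_derive Delta t -> ex_derive (pfun rho) t ->
  is_derive (wfun a mu Delta rho) t
    (pfun rho t / t * (wfun a mu Delta rho t - 1
                       + Tfun a mu Delta rho t / (a ^ 2 * Delta t ^ 2))).
Proof.
  intros Ha Ht HD HeD Hep. unfold wfun, Tfun.
  apply is_derive_ext with
    (fun t => (a ^ 2 - mu * t) * pfun rho t ^ 2 / (a ^ 2 * Delta t)); [reflexivity|].
  generalize dependent (pfun rho). intros p Hep.
  auto_derive.
  - repeat split; auto. repeat apply Rmult_integral_contrapositive_currified; auto.
  - change (Derive (fun x => p x)) with (Derive p).
    change (Derive (fun x => Delta x)) with (Derive Delta).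
    field; auto.
Qed.

(** The terms in [Derive Delta] of [t X] and [T / Delta] agree and drop out of the difference, and
    [(a ^ 2 - mu * t) + mu * t = a ^ 2] collects the terms in [Delta] into [3 * Delta]. *)
Lemma is_derive_qfun (m : nat) (a mu mubar : R) (Delta rho : R -> R) (t : R) :
  a <> 0 -> t <> 0 -> Delta t <> 0 -> ex_derive (pfun rho) t ->
  is_derive (qfun a mu rho) t
    (pfun rho t / (2 * t)
     * (2 * INR m - 3 * Delta t - (2 * INR m - 3) * qfun a mu rho t
        - (2 * INR m - 1) * (mubar / a ^ 2) * varrho rho t
        - (Xfun (2 * m) a mu mubar Delta rho t * t
           - Tfun a mu Delta rho t / Delta t) / a ^ 2)).
Proof.
  intros Ha Ht HD Hep. unfold qfun, Tfun, Xfun, varrho.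
  rewrite mult_INR. replace (INR 2) with 2 by (simpl; ring).
  generalize dependent (pfun rho). intros p Hep.
  auto_derive.
  - repeat split; auto.
  - change (Derive (fun x => p x)) with (Derive p).
    field; auto.
Qed.

(** The defects enter the two derivatives with nonzero coefficients because [p <> 0]: the equation
    for [w] forces [T = 0], and then the equation for [q] forces [X = 0]. *)
Lemma system_iff_derivatives (m : nat) (a mu mubar : R) (Delta rho : R -> R) (t : R) :
  a <> 0 -> 0 < t -> 0 < Delta t -> 0 < a ^ 2 - mu * t -> pfun rho t <> 0 ->
  ex_derive Delta t -> ex_derive (pfun rho) t ->
  (Xfun (2 * m) a mu mubar Delta rho t = 0 /\ Tfun a mu Delta rho t = 0)
  <->
  (is_derive (wfun a mu Delta rho) t (pfun rho t / t * (wfun a mu Delta rho t - 1)) /\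
   is_derive (qfun a mu rho) t
     (pfun rho t / (2 * t)
      * (2 * INR m - (3 / wfun a mu Delta rho t + 2 * INR m - 3) * qfun a mu rho t
         - (2 * INR m - 1) * (mubar / a ^ 2) * varrho rho t))).
Proof.
  intros Ha Ht HD HA Hp HeD Hep.
  pose proof (is_derive_wfun a mu Delta rho t Ha) as Hw.
  pose proof (is_derive_qfun m a mu mubar Delta rho t Ha) as Hq.
  (* This identity turns [3 * Delta] into [(3 / w) * q]. *)
  assert (HqD : qfun a mu rho t / wfun a mu Delta rho t = Delta t).
  { unfold qfun, wfun. field. repeat split; auto; lra. }
  replace (3 / wfun a mu Delta rho t + 2 * INR m - 3)
    with (3 * / wfun a mu Delta rho t + (2 * INR m - 3)) by (unfold Rdiv; ring).
  replace ((3 * / wfun a mu Delta rho t + (2 * INR m - 3)) * qfun a mu rho t)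
    with (3 * Delta t + (2 * INR m - 3) * qfun a mu rho t)
    by (rewrite <- HqD; unfold Rdiv; ring).
  specialize (Hw ltac:(lra) ltac:(lra) HeD Hep).
  specialize (Hq ltac:(lra) ltac:(lra) Hep).
  split.
  - intros [HX HT]. rewrite HT in Hw, Hq. rewrite HX in Hq. split.
    + evar_last; [exact Hw|]. unfold Rdiv. ring.
    + evar_last; [exact Hq|]. unfold Rdiv. ring.
  - intros [Hw' Hq'].
    apply is_derive_unique in Hw, Hq, Hw', Hq'. rewrite Hw in Hw'. rewrite Hq in Hq'.
    assert (HT : Tfun a mu Delta rho t = 0).
    { apply Rmult_eq_reg_l with (pfun rho t / t / (a ^ 2 * Delta t ^ 2)).
      - replace (_ * 0) with 0 by ring.
        unfold Rdiv in *. lra.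
      - unfold Rdiv. repeat apply Rmult_integral_contrapositive_currified; auto;
          apply Rinv_neq_0_compat;
          repeat apply Rmult_integral_contrapositive_currified; auto; lra. }
    split; auto. rewrite HT in Hq'.
    apply Rmult_eq_reg_l with (pfun rho t / (2 * t) * t / a ^ 2).
    + unfold Rdiv in *. lra.
    + unfold Rdiv. repeat apply Rmult_integral_contrapositive_currified; auto;
        try apply Rinv_neq_0_compat;
        repeat apply Rmult_integral_contrapositive_currified; auto; lra.
Qed.

(** The factor [r' = p r / t] of the chain rule cancels the [1 / (2 r)] in [slope]. The result is
    the equation for [q] with [w = 1 + E r]. *)
Lemma is_derive_profile_varrho (m : nat) (a mubar E F : R) (rho : R -> R) (t : R) :
  (2 <= m)%nat -> 0 < t -> ex_derive rho t -> 0 < 1 + E * varrho rho t ->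
  is_derive (fun t => profile m a mubar E F (varrho rho t)) t
    (pfun rho t / (2 * t)
     * (2 * INR m - (3 / (1 + E * varrho rho t) + 2 * INR m - 3)
                    * profile m a mubar E F (varrho rho t)
        - (2 * INR m - 1) * (mubar / a ^ 2) * varrho rho t)).
Proof.
  intros Hm Ht Hrho HE.
  assert (Hr : 0 < varrho rho t) by (apply Rmult_lt_0_compat; auto; apply exp_pos).
  evar_last.
  - apply (is_derive_comp (profile m a mubar E F)).
    + now apply is_derive_profile.
    + apply is_derive_varrho; auto; lra.
  - unfold slope. change (@scal _ _) with Rmult.
    generalize dependent (profile m a mubar E F (varrho rho t)). intros.
    generalize (mubar / a ^ 2). intros. field. repeat split; lra.
Qed.

(** * The differentiated implicit relation *)

(** Squaring gives the formula for [q], since [s ^ 2 = 1] and [c ^ 2 = a ^ 2]. The information lost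
    by squaring is that [s * p] and [c] have the same sign. *)
Lemma sqrt_speed_iff (a A c p q s : R) :
  a <> 0 -> 0 < A -> c ^ 2 = a ^ 2 -> p <> 0 -> s = 1 \/ s = -1 -> 0 < q ->
  s * p / sqrt q = c / sqrt A <-> q = A * p ^ 2 / a ^ 2 /\ 0 < s * c * p.
Proof.
  intros Ha HA Hc Hp Hs Hq.
  pose proof (sqrt_lt_R0 _ HA) as HsA. pose proof (sqrt_lt_R0 _ Hq) as Hsq.
  assert (HA2 : sqrt A ^ 2 = A) by (apply pow2_sqrt; lra).
  assert (Hq2 : sqrt q ^ 2 = q) by (apply pow2_sqrt; lra).
  assert (Hs2 : s ^ 2 = 1) by (destruct Hs as [-> | ->]; ring).
  assert (Ha2 : 0 < a ^ 2) by (apply pow2_gt_0; auto).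
  assert (Hc0 : c <> 0) by (intros ->; lra).
  split.
  - intros H.
    assert (Heq : s * p * sqrt A = c * sqrt q).
    { replace (s * p * sqrt A) with (s * p / sqrt q * sqrt q * sqrt A) by (field; lra).
      rewrite H. field. lra. }
    split.
    + apply Rmult_eq_reg_r with (a ^ 2); [|lra].
      replace (A * p ^ 2 / a ^ 2 * a ^ 2) with (A * p ^ 2) by (field; lra).
      rewrite <- Hc, <- Hq2 at 1.
      replace (sqrt q ^ 2 * c ^ 2) with ((c * sqrt q) ^ 2) by ring.
      rewrite <- Heq. replace ((s * p * sqrt A) ^ 2) with (s ^ 2 * p ^ 2 * sqrt A ^ 2) by ring.
      rewrite Hs2, HA2. ring.
    + apply Rmult_lt_reg_r with (sqrt A); auto.
      replace (s * c * p * sqrt A) with (c * (s * p * sqrt A)) by ring.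
      rewrite Heq. replace (c * (c * sqrt q)) with (c ^ 2 * sqrt q) by ring.
      rewrite Hc. rewrite Rmult_0_l. now apply Rmult_lt_0_compat.
  - intros [Hqe Hsgn].
    assert (Hsqe : sqrt q = sqrt A * (s * c * p) / a ^ 2).
    { apply sqrt_lem_1; try lra.
      - apply Rlt_le, Rdiv_lt_0_compat; auto. now apply Rmult_lt_0_compat.
      - replace (_ * _) with (sqrt A ^ 2 * s ^ 2 * c ^ 2 * p ^ 2 / (a ^ 2) ^ 2)
          by (field; auto).
        rewrite HA2, Hs2, Hc, Hqe. field; auto. }
    rewrite Hsqe, <- Hc. field. repeat split; auto; lra.
Qed.

(** The left side is the derivative of an antiderivative of [f] along [varrho], as [r' = p r / t];
    the right side has the shape treated by [sqrt_speed_iff], divided by [t]. *)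
Lemma f_mul_log_derivative (m : nat) (a mubar E F s r p t : R) : 0 < r ->
  Defs.f m a mubar E F s r * (p * r / t) = s * p / sqrt (profile m a mubar E F r) / t.
Proof.
  intros Hr. rewrite f_profile by assumption. unfold Rdiv. rewrite Rinv_mult.
  generalize (/ sqrt (profile m a mubar E F r)) (/ t). intros. field. lra.
Qed.

(** * Equivalence of the system with the explicit formulas *)

Theorem lemma7p1 (m n : nat) (hm : (2 <= m)%nat) (hn : n = (2 * m)%nat)
    (a mu mubar : R) (ha : a <> 0)
    (lo hi : Rbar) (hlo : Rbar_le 0 lo) (hlohi : Rbar_lt lo hi)
    (hpos : forall t : R, in_itv lo hi t -> 0 < a ^ 2 - mu * t)
    (Delta rho : R -> R)
    (hDelta : smooth_on (in_itv lo hi) Delta)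
    (hrho : smooth_on (in_itv lo hi) rho)
    (hDelta_pos : forall t : R, in_itv lo hi t -> 0 < Delta t)
    (hp : forall t : R, in_itv lo hi t -> 1 + 2 * t * Derive rho t <> 0) :
  (forall t : R, in_itv lo hi t ->
     Xfun n a mu mubar Delta rho t = 0 /\ Tfun a mu Delta rho t = 0)
  <->
  (exists E F s : R, (s = 1 \/ s = -1) /\
     (forall t : R, in_itv lo hi t ->
        Delta t = (a ^ 2 - mu * t) * (1 + 2 * t * Derive rho t) ^ 2
                  / (a ^ 2 * (1 + E * t * exp (2 * rho t)))) /\
     exists G : R -> R,
       antiderivative_f m a mubar E F s (in_itv lo hi) rho G /\
       (forall t : R, in_itv lo hi t ->
          log_side a mu t = G (varrho rho t))).
Proof.
  subst n.
  assert (Hpt : forall t, in_itv lo hi t ->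
            0 < t /\ 0 < varrho rho t /\ ex_derive rho t /\ ex_derive Delta t
            /\ ex_derive (pfun rho) t).
  { intros t Ht.
    assert (Ht0 : 0 < t) by exact (Rbar_le_lt_trans _ _ _ hlo (proj1 Ht)).
    split; [exact Ht0|]. split; [apply Rmult_lt_0_compat; auto; apply exp_pos|].
    split; [exact (hrho 1%nat t Ht)|]. split; [exact (hDelta 1%nat t Ht)|].
    assert (H2 : ex_derive (Derive rho) t) by exact (hrho 2%nat t Ht).
    unfold pfun. auto_derive. repeat split; auto. }
  assert (Hw : forall t, in_itv lo hi t -> 0 < wfun a mu Delta rho t).
  { intros t Ht. unfold wfun, pfun.
    apply Rdiv_lt_0_compat; apply Rmult_lt_0_compat; auto; apply pow2_gt_0; auto. }
  assert (Hq : forall t, in_itv lo hi t -> 0 < qfun a mu rho t).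
  { intros t Ht. unfold qfun, pfun.
    apply Rdiv_lt_0_compat; [apply Rmult_lt_0_compat; auto|]; apply pow2_gt_0; auto. }
  assert (Hvarrho : forall t, in_itv lo hi t ->
            is_derive (varrho rho) t (pfun rho t * varrho rho t / t)).
  { intros t Ht. destruct (Hpt t Ht) as (H0 & _ & H1 & _).
    apply is_derive_varrho; auto; lra. }
  assert (HL : forall t, in_itv lo hi t ->
            is_derive (log_side a mu) t (log_side_num a mu / sqrt (a ^ 2 - mu * t) / t)).
  { intros t Ht. destruct (Hpt t Ht) as (H0 & _). evar_last.
    - apply is_derive_log_side; auto.
    - pose proof (sqrt_lt_R0 _ (hpos t Ht)). field. lra. }
  assert (HDw : forall E t, in_itv lo hi t -> 0 < 1 + E * varrho rho t ->
            Delta t = (a ^ 2 - mu * t) * (1 + 2 * t * Derive rho t) ^ 2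
                  / (a ^ 2 * (1 + E * t * exp (2 * rho t)))
            <-> wfun a mu Delta rho t = 1 + E * varrho rho t).
  { intros E t Ht HE. pose proof (hpos t Ht). pose proof (hDelta_pos t Ht).
    pose proof (hp t Ht).
    replace (E * t * exp (2 * rho t)) with (E * varrho rho t) by (unfold varrho; ring).
    unfold wfun, pfun. split; [intros -> | intros <-];
      field; repeat split; auto; lra. }
  transitivity (forall t, in_itv lo hi t ->
   is_derive (wfun a mu Delta rho) t (pfun rho t / t * (wfun a mu Delta rho t - 1)) /\
   is_derive (qfun a mu rho) t
     (pfun rho t / (2 * t)
      * (2 * INR m - (3 / wfun a mu Delta rho t + 2 * INR m - 3) * qfun a mu rho t
         - (2 * INR m - 1) * (mubar / a ^ 2) * varrho rho t))).
  { split; intros H t Ht; destruct (Hpt t Ht) as (H0 & H1 & H2 & H3 & H4);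
      apply system_iff_derivatives; auto; exact (hp t Ht). }
  (* The constants [E] and [F], the sign [s] and the lower limit of the integral are all fixed at
     this base point. *)
  destruct (in_itv_inhabited lo hi hlo hlohi) as [t0 Ht0].
  split.
  - intros Hode.
    (* Both [w - 1] and [varrho] satisfy [t y' = p y], so their quotient is a constant, [E]. *)
    assert (HE : exists E, forall t, in_itv lo hi t ->
              wfun a mu Delta rho t = 1 + E * varrho rho t).
    { exists ((wfun a mu Delta rho t0 - 1) / varrho rho t0). intros t Ht.
      rewrite (constant_on_itv lo hi
                 (fun t => (wfun a mu Delta rho t - 1) / varrho rho t)) with t0 t; auto.
      - destruct (Hpt t Ht) as (H0 & H1 & _). field. lra.
      - clear t Ht. intros t Ht. destruct (Hpt t Ht) as (H0 & H1 & _). evar_last.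
        + apply (is_derive_div (fun t => wfun a mu Delta rho t - 1)); [| |lra].
          * apply (is_derive_minus (wfun a mu Delta rho) (fun _ => 1)).
            -- exact (proj1 (Hode t Ht)).
            -- apply @is_derive_const.
          * apply (Hvarrho t Ht).
        + change (@zero _) with 0. unfold minus. change (@plus _) with Rplus.
          change (@opp _) with Ropp. field. lra. }
    destruct HE as [E HE].
    assert (HE0 : forall t, in_itv lo hi t -> 0 < 1 + E * varrho rho t).
    { intros t Ht. rewrite <- HE; auto. }
    assert (HF : exists F, forall t, in_itv lo hi t ->
              qfun a mu rho t = profile m a mubar E F (varrho rho t)).
    (* The functions [q] and [profile] with [F = 0] solve the same linear equation. Their difference
       solves the homogeneous one, as does [profile_hom], so the quotient is a constant, [F]. *)
    { set (g := fun t => (qfun a mu rho t - profile m a mubar E 0 (varrho rho t))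
                         / profile_hom m E (varrho rho t)).
      exists (g t0). intros t Ht. rewrite profile_affine.
      rewrite (constant_on_itv lo hi g) with t0 t; auto.
      - destruct (Hpt t Ht) as (H0 & H1 & _).
        pose proof (profile_hom_pos m E _ H1 (HE0 t Ht)).
        unfold g. field. lra.
      - clear t Ht. intros t Ht. destruct (Hpt t Ht) as (H0 & H1 & H2 & _).
        pose proof (profile_hom_pos m E _ H1 (HE0 t Ht)).
        pose proof (is_derive_profile_varrho m a mubar E 0 rho t hm H0 H2 (HE0 t Ht)) as HS0.
        pose proof (is_derive_profile_varrho m a mubar E 1 rho t hm H0 H2 (HE0 t Ht)) as HS1.
        destruct (Hode t Ht) as [_ Hqt]. rewrite HE in Hqt by auto.
        (* The derivative of [profile_hom] along [varrho] comes from subtracting the solutions with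
           [F = 1] and [F = 0]. *)
        assert (HH : forall t, profile m a mubar E 1 (varrho rho t)
                  - profile m a mubar E 0 (varrho rho t) = profile_hom m E (varrho rho t)).
        { intros x. rewrite (profile_affine m a mubar E 1). ring. }
        pose proof (is_derive_ext _ _ _ _ HH (is_derive_minus _ _ _ _ _ HS1 HS0)) as HSh.
        evar_last.
        + apply (is_derive_div
                   (fun t => qfun a mu rho t - profile m a mubar E 0 (varrho rho t))
                   (fun t => profile_hom m E (varrho rho t))); [| exact HSh | lra].
          exact (is_derive_minus _ _ _ _ _ Hqt HS0).
        + rewrite (profile_affine m a mubar E 1).
          unfold minus. change (@plus _) with Rplus. change (@opp _) with Ropp.
          unfold Rdiv. ring. }
    destruct HF as [F HF].
    assert (Hc0 : log_side_num a mu <> 0).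
    { intros H. pose proof (log_side_num_sqr a mu) as H2. rewrite H in H2.
      pose proof (pow2_gt_0 a ha). lra. }
    (* The sign is chosen at [t0] and persists, because [p] is continuous and never zero. *)
    assert (Hs : exists s, (s = 1 \/ s = -1) /\ forall t, in_itv lo hi t ->
              0 < s * log_side_num a mu * pfun rho t).
    { assert (Hs : forall s, s <> 0 -> 0 < s * log_side_num a mu * pfun rho t0 ->
              forall t, in_itv lo hi t -> 0 < s * log_side_num a mu * pfun rho t).
      { intros s Hs0 Hs t Ht.
        apply (constant_sign_on_itv lo hi (fun t => s * log_side_num a mu * pfun rho t))
          with t0; auto.
        - intros y Hy. apply (continuous_mult (fun _ => s * log_side_num a mu)).
          + apply continuous_const.
          + apply (ex_derive_continuous (pfun rho)). apply Hpt, Hy.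
        - intros y Hy. repeat apply Rmult_integral_contrapositive_currified; auto.
          exact (hp y Hy). }
      assert (log_side_num a mu * pfun rho t0 <> 0).
      { apply Rmult_integral_contrapositive_currified; auto. exact (hp t0 Ht0). }
      destruct (Rlt_le_dec 0 (log_side_num a mu * pfun rho t0)).
      - exists 1. split; auto. apply Hs; lra.
      - exists (-1). split; auto. apply Hs; lra. }
    destruct Hs as (s & Hs & Hsgn).
    exists E, F, s. split; auto. split.
    { intros t Ht. apply HDw; auto. }
    assert (Hreg : forall t, in_itv lo hi t -> regular m a mubar E F (varrho rho t)).
    { intros t Ht. destruct (Hpt t Ht) as (H0 & H1 & _). repeat split; auto.
      apply profile_pos_iff; auto. rewrite <- HF; auto. }
    assert (HG : forall t, in_itv lo hi t ->
              is_derive (RInt (Defs.f m a mubar E F s) (varrho rho t0)) (varrho rho t)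
                (Defs.f m a mubar E F s (varrho rho t))).
    { intros t Ht. apply is_derive_RInt_regular with (regular m a mubar E F).
      - intros y. now apply continuous_f.
      - apply locally_regular; auto.
      (* A point between two values of [varrho] is itself a value of [varrho], hence lies in the
         domain of [f]. *)
      - intros y Hy.
        destruct (IVT_on_itv lo hi (varrho rho) t0 t y) as (z & Hz & <-); auto.
        intros x Hx. exact (is_derive_continuous _ _ _ (Hvarrho x Hx)). }
    (* The additive constant makes the relation hold at [t0], where the integral vanishes. *)
    exists (fun r => log_side a mu t0
                     + RInt (Defs.f m a mubar E F s) (varrho rho t0) r).
    split.
    + intros t Ht. destruct (Hreg t Ht) as (_ & H1 & H2). do 2 (split; auto).
      evar_last.
      * apply (is_derive_plus (fun _ => log_side a mu t0)); [apply @is_derive_const|].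
        apply HG, Ht.
      * apply plus_zero_l.
    + intros t Ht.
      (* The relation extends from [t0] to the whole interval because the difference of its two
         sides has zero derivative, by [sqrt_speed_iff] applied to [q]. *)
      pose proof (fun H => constant_on_itv lo hi (fun t => log_side a mu t
        - RInt (Defs.f m a mubar E F s) (varrho rho t0) (varrho rho t)) H t0 t) as Hcst.
      simpl in Hcst.
      rewrite RInt_point in Hcst. change (@zero _) with 0 in Hcst.
      enough (log_side a mu t0 - 0 = log_side a mu t
        - RInt (Defs.f m a mubar E F s) (varrho rho t0) (varrho rho t)) by lra.
      apply Hcst; auto. clear t Ht Hcst.
      intros t Ht. destruct (Hpt t Ht) as (H0 & H1 & _). evar_last.
      * apply (is_derive_minus (log_side a mu)); [apply HL, Ht|].
        apply (is_derive_comp (RInt (Defs.f m a mubar E F s) (varrho rho t0))).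
        -- apply HG, Ht.
        -- apply Hvarrho, Ht.
      * unfold minus. change (@plus _) with Rplus. change (@opp _) with Ropp.
        change (@scal _ _) with Rmult.
        rewrite (Rmult_comm _ (Defs.f m a mubar E F s (varrho rho t))).
        rewrite f_mul_log_derivative, <- HF by auto.
        rewrite (proj2 (sqrt_speed_iff a (a ^ 2 - mu * t) (log_side_num a mu)
                   (pfun rho t) (qfun a mu rho t) s ha (hpos t Ht)
                   (log_side_num_sqr a mu) (hp t Ht) Hs (Hq t Ht))).
        -- ring.
        -- split; auto.
  - intros (E & F & s & Hs & HD & G & HG & HLG).
    assert (HwE : forall t, in_itv lo hi t ->
              wfun a mu Delta rho t = 1 + E * varrho rho t).
    { intros t Ht. apply HDw; auto. apply (HG t Ht). }
    (* Differentiating the implicit relation equates the two speeds in [sqrt_speed_iff], which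
       identifies [profile] along [varrho] with [q]. *)
    assert (HqS : forall t, in_itv lo hi t ->
              qfun a mu rho t = profile m a mubar E F (varrho rho t)).
    { intros t Ht. destruct (Hpt t Ht) as (H0 & H1 & _).
      destruct (HG t Ht) as (_ & HR & HGt).
      apply profile_pos_iff in HR; auto.
      symmetry. apply (sqrt_speed_iff a (a ^ 2 - mu * t) (log_side_num a mu)
                         (pfun rho t) _ s); auto.
      - apply log_side_num_sqr.
      - exact (hp t Ht).
      - apply Rmult_eq_reg_r with (/ t); [|apply Rinv_neq_0_compat; lra].
        change (s * pfun rho t / sqrt (profile m a mubar E F (varrho rho t)) / t
                = log_side_num a mu / sqrt (a ^ 2 - mu * t) / t).
        rewrite <- f_mul_log_derivative by auto.
        rewrite <- (is_derive_unique _ _ _ (HL t Ht)). symmetry.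
        apply is_derive_unique.
        rewrite (Rmult_comm (Defs.f m a mubar E F s (varrho rho t))).
        apply is_derive_ext_loc with (fun t => G (varrho rho t)).
        + apply (filter_imp (in_itv lo hi)); [|now apply locally_in_itv].
          intros x Hx. symmetry; auto.
        + apply (is_derive_comp G); [exact HGt | apply Hvarrho, Ht]. }
    (* Near [t], [w] and [q] coincide with [1 + E * varrho] and [profile] along [varrho], whose
       derivatives are known. *)
    intros t Ht. destruct (Hpt t Ht) as (H0 & H1 & H2 & _).
    rewrite HwE by auto. split.
    + apply is_derive_ext_loc with (fun t => 1 + E * varrho rho t).
      * apply (filter_imp (in_itv lo hi)); [|now apply locally_in_itv].
        intros x Hx. symmetry; auto.
      * evar_last.
        -- apply (is_derive_plus (fun _ => 1)); [apply @is_derive_const|].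
           apply is_derive_scal, Hvarrho, Ht.
        -- rewrite plus_zero_l. field. lra.
    + rewrite HqS by auto.
      apply is_derive_ext_loc with (fun t => profile m a mubar E F (varrho rho t)).
      * apply (filter_imp (in_itv lo hi)); [|now apply locally_in_itv].
        intros x Hx. symmetry; auto.
      * apply is_derive_profile_varrho; auto. apply (HG t Ht).
Qed.
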